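(* There exists a class $\mathcal{D}$ of graphs such that: (1) every graph of $\mathcal{D}$ is either a clique or admits a star-cutset decomposition $(G_1,G_2)$ with $G_1,G_2\in\mathcal{D}$; and (2) $\mathcal{D}$ does not have the polynomial CS-Separation property.
   Context: A cut of $G$ is a partition $(W,W')$ of $V(G)$; it separates disjoint $K,S$ if $K\subseteq W$, $S\subseteq W'$. A CS-Separator of $G$ is a family of cuts such that every clique $K$ and stable set $S$ of $G$ with $K\cap S=\emptyset$ are separated by some cut; its size is the number of cuts. A class has the polynomial CS-Separation property if there is a polynomial $P$ such that every graph $G$ in the class admits a CS-Separator of size at most $P(|V(G)|)$. A star-cutset of $G$ is a set $X\subseteq V(G)$ such that $G\setminus X$ is disconnected and some $x\in X$ is adjacent to every vertex of $X\setminus\{x\}$. Given a star-cutset $X$ and a partition $(V_1,V_2)$ of $V(G)\setminus X$ into nonempty sets with no edges between $V_1$ and $V_2$, the pair $(G[V_1\cup X],G[V_2\cup X])$ is a star-cutset decomposition of $G$. *)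

(* Defs.v *)
From HB Require Import structures.
From mathcomp Require Import all_boot all_order all_algebra.

Set Implicit Arguments.
Unset Strict Implicit.
Unset Printing Implicit Defensive.

Import Order.TTheory GRing.Theory Num.Theory.

Record sgraph := SGraph {
  vertex :> finType;
  edge : rel vertex;
  edge_sym : symmetric edge;
  edge_irrefl : irreflexive edge
}.

Definition induced_edge (G : sgraph) (A : {set G}) : rel {x : G | x \in A} :=
  fun x y => edge (val x) (val y).

Lemma induced_edge_sym (G : sgraph) (A : {set G}) :
  symmetric (@induced_edge G A).
Proof. by move=> x y; apply: edge_sym. Qed.

Lemma induced_edge_irrefl (G : sgraph) (A : {set G}) :
  irreflexive (@induced_edge G A).
Proof. by move=> x; apply: edge_irrefl. Qed.

Definition induced (G : sgraph) (A : {set G}) : sgraph :=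
  SGraph (@induced_edge_sym G A) (@induced_edge_irrefl G A).

Definition isomorphic (G H : sgraph) : Prop :=
  exists2 f : G -> H, bijective f & forall x y, edge (f x) (f y) = edge x y.

(* Graph classes are closed under isomorphism, so that membership of a graph
   does not depend on the names of its vertices. *)
Record graph_class := GraphClass {
  in_class :> sgraph -> Prop;
  in_class_iso : forall G H : sgraph,
    isomorphic G H -> in_class G -> in_class H
}.

Definition clique (G : sgraph) (K : {set G}) : Prop :=
  {in K &, forall x y, x != y -> edge x y}.

Definition stable (G : sgraph) (S : {set G}) : Prop :=
  {in S &, forall x y, ~~ edge x y}.

Definition complete (G : sgraph) : Prop := clique [set: G].

(* Under this convention the graph without vertices is connected. *)
Definition connected (G : sgraph) : Prop :=
  forall x y : G, connect (@edge G) x y.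

(* The two sides of a cut are ordered and may be empty: the clique set0 and the
   stable set V(G) of an edgeless graph are only separated by (set0, V(G)). *)
Definition cut (G : sgraph) (c : {set G} * {set G}) : Prop :=
  c.1 :|: c.2 = [set: G] /\ [disjoint c.1 & c.2].

Definition separates (G : sgraph) (c : {set G} * {set G}) (K S : {set G}) :
    Prop :=
  K \subset c.1 /\ S \subset c.2.

Definition CS_separator (G : sgraph) (F : {set {set G} * {set G}}) : Prop :=
  (forall c, c \in F -> cut c) /\
  (forall K S : {set G}, clique K -> stable S -> [disjoint K & S] ->
     exists2 c, c \in F & separates c K S).

(* Rational coefficients are no restriction: on natural numbers, every real
   polynomial is bounded by one with natural coefficients. *)
Definition polynomial_CS_separation (C : graph_class) : Prop :=
  exists P : {poly rat}, forall G : sgraph, C G ->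
    exists2 F : {set {set G} * {set G}},
      CS_separator F & (#|F|%:R <= P.[#|G|%:R])%R.

Definition star_cutset (G : sgraph) (X : {set G}) : Prop :=
  ~ connected (induced (~: X)) /\
  exists2 x, x \in X & forall y, y \in X :\ x -> edge x y.

Definition star_cutset_decomposition (G G1 G2 : sgraph) : Prop :=
  exists X V1 V2 : {set G},
    [/\ star_cutset X,
        [/\ V1 :|: V2 = ~: X, [disjoint V1 & V2], V1 != set0 & V2 != set0],
        forall x y, x \in V1 -> y \in V2 -> ~~ edge x y,
        G1 = induced (V1 :|: X)
      & G2 = induced (V2 :|: X)].

(* Main.v *)
(** Graphs with a universal vertex [u] form a suitable class: if [a], [b] are not
adjacent, the complement of [{a, b}] is a star-cutset centred at [u], and both
sides of the decomposition keep [u].  Adding a universal vertex does not affect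
CS-separators, so a superpolynomial lower bound for some graphs is needed.

It comes from a query problem: partial assignments ("certificates") of [k]
variables, pairwise contradictory, and a total assignment [z] extending none of
them, such that any fewer than [c] values of [z] are consistent with some
certificate.  Let each variable [v] be replaced by a table of [q] symbols (held
by one player) and a pointer into it (held by the other).  The vertices of the
graph are the pairs (certificate, pointers for its variables), adjacent when the
pointers are compatible; a pointer assignment is a clique, a table a stable set,
and they meet when the symbols pointed at satisfy a certificate.  A CS-separator
thus covers the pairs reading [z] by rectangles free of certificates.  In such a
rectangle, up to about [q ^ (n - c)] exceptions among the [q ^ n] pointer
assignments, a pointer assignment is surrounded by many others which agree with
it in fewer than [c] variables and are otherwise disjoint; each of them
independently has a constant chance to read a certificate.  So about [q ^ c]
cuts are needed, on [O(q ^ k)] vertices, while [c / k] is unbounded for the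
following certificates.

Take [t ^ 2] layers, each with [t] white and [t ^ 2] black cells.  A white
witness has, in each layer, one black cell or all the white ones, the latter in
at most [t] layers; a black witness is made of all black cells and one white
cell of some layer.  These have [O(t ^ 2)] cells, any white witness meets any
black one, and in the natural colouring [t ^ 3] cells must be read to refute all
white witnesses, or all black ones.  Witnesses of prescribed colours on
[m = log (t ^ 3)] copies, together with a lookup table of [2 ^ m] entries whose
entry at the colour vector names the witnesses, are pairwise contradictory. *)
Require Import Defs.
From mathcomp Require Import all_boot all_order all_algebra.
From mathcomp Require Import zify.

Set Implicit Arguments.
Unset Strict Implicit.
Unset Printing Implicit Defensive.

Import Order.TTheory GRing.Theory Num.Theory.

Lemma leq_card_bigcup (I T : finType) (P : pred I) (F : I -> {set T}) :
  #|\bigcup_(i | P i) F i| <= \sum_(i | P i) #|F i|.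
Proof.
elim/big_rec2: _ => [|i n A _ IH]; first by rewrite cards0.
by apply: leq_trans (leq_card_setU _ _) _; rewrite leq_add2l.
Qed.

(** * Tables read through pointers *)

Section Lift.
Variables (V C Q : finType) (z : {ffun V -> C}) (c R : nat).

Definition read (y : {ffun V * Q -> C}) (a : {ffun V -> Q}) : {ffun V -> C} :=
  [ffun v => y (v, a v)].

Definition overwrite (w : {ffun V -> C}) (a : {ffun V -> Q})
    (y : {ffun V * Q -> C}) : {ffun V * Q -> C} :=
  [ffun vi => if vi.2 == a vi.1 then w vi.1 else y vi].

Lemma read_overwrite w a y : read (overwrite w a y) a = w.
Proof. by apply/ffunP => v; rewrite !ffunE /= eqxx. Qed.

Lemma overwrite_read w a y : overwrite (read y a) a (overwrite w a y) = y.
Proof.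
apply/ffunP => -[v i]; rewrite !ffunE /=.
by case: eqP => [->|].
Qed.

(** As sets of table cells, [b] and [b'] meet only inside [a]. *)
Definition apart (a b b' : {ffun V -> Q}) : bool :=
  [forall v, (b v == b' v) ==> (b v == a v)].

(** Outside [a] the members of [L] use disjoint cells, so each independently reads [w b] with
    probability at least [1 / #|{ffun V -> C}|]; denominators are cleared. *)
Lemma avoid_card (a : {ffun V -> Q}) (L : seq {ffun V -> Q})
    (w : {ffun V -> Q} -> {ffun V -> C}) :
  pairwise (apart a) L ->
  {in L, forall b : {ffun V -> Q}, forall v, b v = a v -> w b v = z v} ->
  #|[set y | all (fun b => read (overwrite z a y) b != w b) L]|
    * #|{ffun V -> C}| ^ size L
  <= #|{ffun V * Q -> C}| * #|{ffun V -> C}|.-1 ^ size L.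
Proof.
elim: L => [|b L IH] /=; first by rewrite !expn0 !muln1 max_card.
case/andP=> ab pL wz.
have {}IH := IH pL (fun b' hb' => wz b' (mem_behead (s := b :: L) hb')).
(* Writing [w b] at the cells [(v, b v)] preserves the other conditions and
   forgets only #|V| symbols, so a positive fraction of E leaves E'. *)
set E := [set y | all _ L] in IH.
set E' := [set y | _].
have sE : E' \subset E by apply/subsetP => y; rewrite !inE => /andP[].
have ov y : y \in E -> overwrite (w b) b y \in E :\: E'.
  move=> yE.
  have ovE : overwrite (w b) b y \in E.
    move: yE; rewrite !inE => /allP yE; apply/allP => b' b'L.
    apply: contraNneq (yE b' b'L) => <-; apply/eqP/ffunP => v; rewrite !ffunE /=.
    case: (eqVneq (b' v) (a v)) => // nb'.
    case: eqP => // b'b; have /allP/(_ _ b'L)/forallP/(_ v) := ab.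
    by rewrite b'b eqxx /= -b'b (negPf nb').
  rewrite inE ovE andbT inE negb_and negbK; apply/orP; left.
  apply/eqP/ffunP => v; rewrite !ffunE /= eqxx; case: eqP => // ba.
  by rewrite wz ?mem_head.
have fib : #|E| <= #|E :\: E'| * #|{ffun V -> C}|.
  pose phi y := (overwrite (w b) b y, read y b).
  have injphi : injective phi.
    by move=> y y' [h1 h2]; rewrite -(overwrite_read (w b) b y) h1 h2 overwrite_read.
  rewrite -(card_imset _ injphi).
  have -> : #|{ffun V -> C}| = #|[set: {ffun V -> C}]| by rewrite cardsT.
  rewrite -cardsX; apply: subset_leq_card; apply/subsetP => _ /imsetP[y yE ->].
  by rewrite inE /= ov // inE.
rewrite cardsD (setIidPr sE) in fib.
have h : #|E'| * #|{ffun V -> C}| <= #|E| * #|{ffun V -> C}|.-1.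
  have := subset_leq_card sE; move: fib.
  by case: #|{ffun V -> C}| => [|n]; rewrite ?muln0 //=; nia.
rewrite !expnS mulnA; apply: leq_trans (leq_mul h (leqnn _)) _.
by rewrite mulnAC [X in _ <= X]mulnCA mulnC leq_mul2l IH orbT.
Qed.

(** * Pointer assignments that centre no sunflower *)

Lemma subcube_card (T : {set V}) (al : {ffun V -> Q}) (B : {set {ffun V -> Q}}) :
  {in B & T, forall (b : {ffun V -> Q}) v, b v = al v} -> #|B| * #|Q| ^ #|T| <= #|Q| ^ #|V|.
Proof.
move=> h.
pose F v := if v \in T then pred1 (al v) else predT.
have sB : #|B| <= #|(family F : simpl_pred {ffun V -> Q})|.
  apply: subset_leq_card; apply/subsetP => b bB; apply/familyP => v.
  by rewrite /F; case: ifP => // vT; rewrite inE (h b v).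
apply: leq_trans (leq_mul sB (leqnn _)) _.
rewrite card_family foldrE big_map big_enum /= (bigID (mem T)) /=.
rewrite big1 => [|v vT]; last by rewrite /F vT card1.
rewrite (eq_bigr (fun=> #|Q|)) => [|v vT]; last by rewrite /F (negPf vT); apply: eq_card.
by rewrite mul1n prod_nat_const -expnD -[#|V|](cardC (mem T)) addnC leqnn.
Qed.

(* [a] is the centre of a sunflower with [R] petals in [A] whose kernels have
   fewer than [c] coordinates. *)
Definition rich (A : {set {ffun V -> Q}}) (a : {ffun V -> Q}) : bool :=
  [exists L : R.-tuple {ffun V -> Q},
    [&& all (mem A) L, all (fun b : {ffun V -> Q} => #|[set v | b v == a v]| < c) L
      & pairwise (apart a) L]].

(* If more than [R] elements of [B] were pairwise disjoint outside [T], any of them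
   would be rich.  Hence a maximal such family [L] has at most [R] elements, and
   each element of [B] shares a value outside [T] with one of them. *)
Lemma poor_card_rec (A B : {set {ffun V -> Q}}) (T : {set V}) (al : {ffun V -> Q}) j :
  c <= #|V| -> #|T| + j = c -> B \subset A ->
  {in B, forall a : {ffun V -> Q}, ~~ rich A a} ->
  {in B & T, forall (b : {ffun V -> Q}) v, b v = al v} ->
  #|B| * #|Q| ^ c <= (#|V| * R) ^ j * #|Q| ^ #|V|.
Proof.
move=> cV; elim: j B T al => [|j IH] B T al; rewrite ?addn0.
  by move=> <- _ _ /subcube_card; rewrite expn0 mul1n.
move=> Tc BA poor agree.
pose disj (L : {set {ffun V -> Q}}) := (L \subset B) &&
  [forall b : {ffun V -> Q} in L, forall b' : {ffun V -> Q} in L,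
    (b != b') ==> [forall v, (b v == b' v) ==> (v \in T)]].
have disj0 : disj set0 by rewrite /disj sub0set; apply/forallP => b; rewrite inE.
have [L /maxsetP [/andP[LB dL] maxL] _] := maxset_exists disj0.
have {}dL (b b' : {ffun V -> Q}) v :
    b \in L -> b' \in L -> b != b' -> b v = b' v -> v \in T.
  move=> bL b'L bb' e; move/forallP: dL => /(_ b); rewrite bL => /forallP/(_ b').
  by rewrite b'L bb' => /forallP/(_ v); rewrite e eqxx.
have LR : #|L| <= R.
  rewrite leqNgt; apply/negP => RL.
  have /card_gt0P[a aL] : 0 < #|L| by apply: leq_ltn_trans RL.
  have sz : size (take R (enum (L :\ a))) == R.
    by rewrite size_takel // -cardE; have := cardsD1 a L; rewrite aL; lia.
  have mem (b : {ffun V -> Q}) : b \in take R (enum (L :\ a)) -> b != a /\ b \in L.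
    by move=> /mem_take; rewrite mem_enum !inE => /andP[].
  have aB := subsetP LB _ aL.
  case/negP: (poor a aB); apply/existsP; exists (Tuple sz) => /=.
  apply/and3P; split.
  - by apply/allP => b /mem[_ bL]; apply: (subsetP BA); apply: (subsetP LB).
  - apply/allP => b /mem[ba bL]; apply: (@leq_ltn_trans #|T|); last by lia.
    by apply: subset_leq_card; apply/subsetP => v; rewrite inE => /eqP; apply: dL.
  - have un : uniq (take R (enum (L :\ a))) by rewrite take_uniq ?enum_uniq.
    move: un mem; elim: (take _ _) => //= b s IHs /andP[bs us] mem.
    rewrite IHs // ?andbT; last by move=> b' b's; apply: mem; rewrite inE b's orbT.
    apply/allP => b' b's; apply/forallP => v; apply/implyP => /eqP e.
    have [ba bL] := mem b (mem_head _ _).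
    have [b'a b'L] : b' != a /\ b' \in L by apply: mem; rewrite inE b's orbT.
    have vT : v \in T by apply: dL e => //; apply: contraNneq bs => ->.
    by rewrite !(agree _ v) //; apply: (subsetP LB).
pose share (l : {ffun V -> Q}) v :=
  [set b : {ffun V -> Q} in B | (v \notin T) && (b v == l v)].
have cov : B \subset \bigcup_(l in L) \bigcup_(v : V) share l v.
  apply/subsetP => b bB; apply/bigcupP.
  (* A member of [L] shares a value with itself at any variable outside [T]; one exists because
     [#|T| < c <= #|V|]. *)
  have [v0 v0T] : exists v, v \notin T.
    apply/existsP; rewrite -negb_forall; apply/negP => /forallP allT.
    have : #|T| = #|V| by apply: eq_card => v; rewrite allT.
    by lia.
  have [bL|bL] := boolP (b \in L).
    by exists b => //; apply/bigcupP; exists v0 => //; rewrite inE bB v0T eqxx.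
  have [/exists_inP[l lL /existsP[v hv]]|no] :=
      boolP [exists l : {ffun V -> Q} in L,
               [exists v, (v \notin T) && (b v == l v)]].
    by exists l => //; apply/bigcupP; exists v => //; rewrite inE bB.
  have no' (l : {ffun V -> Q}) v : l \in L -> b v = l v -> v \in T.
    move=> lL e; apply/negPn/negP => vT; case/negP: no; apply/exists_inP.
    by exists l => //; apply/existsP; exists v; rewrite vT e eqxx.
  case/negP: bL; rewrite -(maxL (b |: L)) ?setU11 ?subsetU1 //.
  rewrite /disj subUset sub1set bB LB; apply/forall_inP => b1.
  move=> /setU1P h1; apply/forall_inP => b2 /setU1P h2; apply/implyP => ne.
  apply/forallP => v; apply/implyP => /eqP e.
  case: h1 h2 => [h1|h1] [h2|h2].
  - by rewrite h1 h2 eqxx in ne.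
  - by apply: (no' b2) => //; rewrite -h1.
  - by apply: (no' b1) => //; rewrite -h2.
  - exact: dL ne e.
have piece (l : {ffun V -> Q}) v : #|share l v| * #|Q| ^ c
    <= (#|V| * R) ^ j * #|Q| ^ #|V|.
  have [vT|vT] := boolP (v \in T).
    by rewrite (_ : share l v = set0) ?cards0 //; apply/setP => b; rewrite !inE vT andbF.
  (* Prescribing [l v] at [v] adds one variable to [T], at the cost of one unit of [j]. *)
  apply: (IH _ (v |: T) [ffun u => if u == v then l v else al u]).
  - by rewrite cardsU1 vT; lia.
  - by apply: subset_trans BA; apply/subsetP => b; rewrite inE => /andP[].
  - by move=> b; rewrite inE => /andP[bB _]; apply: poor.
  - move=> b u; rewrite inE => /and3P[bB _ /eqP e]; rewrite ffunE.
    by case: eqP => [->//|nuv] /setU1P[//|uT]; apply: agree.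
have bnd : #|B| <= \sum_(l in L) \sum_(v : V) #|share l v|.
  apply: leq_trans (subset_leq_card cov) _; apply: leq_trans (leq_card_bigcup _ _) _.
  by apply: leq_sum => l _; exact: leq_card_bigcup.
apply: leq_trans (leq_mul bnd (leqnn _)) _; rewrite big_distrl /=.
under eq_bigr do rewrite big_distrl /=.
apply: (@leq_trans (\sum_(l in L) \sum_(v : V) (#|V| * R) ^ j * #|Q| ^ #|V|)).
  by apply: leq_sum => l _; apply: leq_sum => v _; apply: piece.
rewrite !sum_nat_const expnS (mulnA #|L|) -[X in _ <= X]mulnA leq_mul2r.
by rewrite [X in _ <= X]mulnC leq_mul2r LR !orbT.
Qed.

Lemma poor_card (A : {set {ffun V -> Q}}) : c <= #|V| ->
  #|[set a in A | ~~ rich A a]| * #|Q| ^ c <= (#|V| * R) ^ c * #|Q| ^ #|V|.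
Proof.
move=> cV; set B := [set a in A | _].
have [->|[al _]] := set_0Vmem B; first by rewrite cards0.
apply: (@poor_card_rec A B set0 al) => //; first by rewrite cards0.
- by apply/subsetP => a; rewrite inE => /andP[].
- by move=> a; rewrite inE => /andP[].
- by move=> a v _; rewrite inE.
Qed.

End Lift.

(** * The certificate graph and its CS-separators *)

Section CertificateGraph.
(* Certificate [i] requires the value [p i s] at the variable [e i s]; repeated
   variables are harmless. *)
Variables (V C I K : finType) (e : I -> K -> V) (p : I -> K -> C).

Definition satisfies (w : {ffun V -> C}) (i : I) : bool :=
  [forall s, w (e i s) == p i s].

Variable Q : finType.

Definition compatible (x y : I * {ffun K -> Q}) : bool :=
  [exists a : {ffun V -> Q},
    [forall s, (a (e x.1 s) == x.2 s) && (a (e y.1 s) == y.2 s)]].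

Lemma compatible_sym : symmetric compatible.
Proof. by move=> x y; apply: eq_existsb => a; apply: eq_forallb => s; rewrite andbC. Qed.

(** [None] is the added universal vertex. *)
Definition cert_edge : rel (option (I * {ffun K -> Q})) := fun u v =>
  match u, v with
  | Some x, Some y => (x != y) && compatible x y
  | None, None => false
  | _, _ => true
  end.

Lemma cert_edge_sym : symmetric cert_edge.
Proof. by move=> [x|] [y|] //=; rewrite eq_sym compatible_sym. Qed.

Lemma cert_edge_irrefl : irreflexive cert_edge.
Proof. by move=> [x|] //=; rewrite eqxx. Qed.

Definition cert_graph : sgraph := SGraph cert_edge_sym cert_edge_irrefl.

Lemma card_cert_graph : #|cert_graph| = (#|I| * #|Q| ^ #|K|).+1.
Proof. by rewrite card_option card_prod card_ffun. Qed.

Definition pointer_clique (a : {ffun V -> Q}) : {set cert_graph} :=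
  [set Some (i, [ffun s => a (e i s)]) | i : I].

Definition input_stable (y : {ffun V * Q -> C}) : {set cert_graph} :=
  [set Some x | x : I * {ffun K -> Q} & [forall s, y (e x.1 s, x.2 s) == p x.1 s]].

Lemma pointer_clique_clique a : clique (pointer_clique a).
Proof.
move=> _ _ /imsetP[i _ ->] /imsetP[j _ ->] ne.
rewrite /= /cert_edge; apply/andP; split=> //.
by apply/existsP; exists a; apply/forallP => s; rewrite !ffunE !eqxx.
Qed.

(** Compatible vertices are satisfied in one common reading of [y], hence share certificate and
    pointers. *)
Lemma input_stable_stable y :
  (forall w i j, satisfies w i -> satisfies w j -> i = j) ->
  stable (input_stable y).
Proof.
move=> unamb _ _ /imsetP[[i al] + ->] /imsetP[[j be] + ->].
rewrite !inE /= => /forallP /= ym /forallP /= ym'; apply/negP => /andP[/negP ne].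
case/existsP => a /forallP /= am; apply: ne; apply/eqP.
have ij : i = j.
  apply: (unamb (read y a)); apply/forallP => s; rewrite ffunE.
    by have /andP[/eqP -> _] := am s.
  by have /andP[_ /eqP ->] := am s.
subst j; congr (_, _); apply/ffunP => s.
by have /andP[/eqP <- /eqP <-] := am s.
Qed.

Lemma meet_satisfies a y x : x \in pointer_clique a -> x \in input_stable y ->
  exists i, satisfies (read y a) i.
Proof.
move=> /imsetP[i _ ->] /imsetP[[j al]]; rewrite inE /= => /forallP /= h [? ?]; subst.
by exists j; apply/forallP => s; rewrite ffunE; have := h s; rewrite ffunE.
Qed.

Lemma satisfies_meet a y i : satisfies (read y a) i ->
  exists2 x, x \in pointer_clique a & x \in input_stable y.
Proof.
move=> /forallP h; exists (Some (i, [ffun s => a (e i s)])).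
  by apply/imsetP; exists i.
apply/imsetP; exists (i, [ffun s => a (e i s)]) => //.
by rewrite inE; apply/forallP => s /=; have := h s; rewrite !ffunE.
Qed.

Variables (z : {ffun V -> C}) (c : nat).
Hypothesis unamb : forall w i j, satisfies w i -> satisfies w j -> i = j.
Hypothesis z_unsat : forall i, ~~ satisfies z i.
Hypothesis z_hard : forall T : {set V}, #|T| < c ->
  exists2 w : {ffun V -> C}, {in T, w =1 z} & exists i, satisfies w i.

Lemma hard_leq : c <= #|V|.
Proof.
rewrite leqNgt; apply/negP => cV.
have [w wz [i wi]] := z_hard (T := setT) ltac:(by rewrite cardsT).
by have := z_unsat i; rewrite -(_ : w = z) ?wi //; apply/ffunP => v; apply: wz.
Qed.

(* All pairs [(a, y)] are counted, the zero of the query problem being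
   [overwrite z a y]: this weights all tables reading [z] at [a] equally. *)
Lemma cut_card R (A : {set {ffun V -> Q}}) (B : {set {ffun V * Q -> C}}) :
  (forall a y i, a \in A -> y \in B -> ~~ satisfies (read y a) i) ->
  #|[set ay | (ay.1 \in A) && (overwrite z ay.1 ay.2 \in B)]|
    * (#|{ffun V -> C}| ^ R * #|Q| ^ c)
  <= #|Q| ^ #|V| * #|{ffun V * Q -> C}|
     * ((#|V| * R) ^ c * #|{ffun V -> C}| ^ R + #|Q| ^ c * #|{ffun V -> C}|.-1 ^ R).
Proof.
move=> mono; set kap := #|{ffun V -> C}|; set Y := #|{ffun V * Q -> C}|.
have -> : #|[set ay | (ay.1 \in A) && (overwrite z ay.1 ay.2 \in B)]|
   = \sum_(a in A) #|[set y | overwrite z a y \in B]|.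
  rewrite -sum1_card; under eq_bigl do rewrite inE.
  rewrite -(pair_big_dep (mem A) (fun a y => overwrite z a y \in B) (fun _ _ => 1)) /=.
  by apply: eq_bigr => a _; rewrite -sum1_card; apply: eq_bigl => y; rewrite inE.
rewrite (bigID (rich c R A)) /= mulnDl addnC mulnDr; apply: leq_add.
  have h : \sum_(a in A | ~~ rich c R A a) #|[set y | overwrite z a y \in B]|
     <= #|[set a in A | ~~ rich c R A a]| * Y.
    rewrite -sum_nat_const; under [X in _ <= X]eq_bigl do rewrite inE.
    by apply: leq_sum => a _; apply: max_card.
  have := leq_mul (poor_card R A hard_leq) (leqnn (Y * kap ^ R)).
  set PP := #|[set a in A | _]| in h *.
  set N := (_ * R) ^ c; set qc := _ ^ c; set qn := _ ^ #|V|.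
  move=> h2; apply: leq_trans (leq_mul h (leqnn _)) _.
  have -> : PP * Y * (kap ^ R * qc) = PP * qc * (Y * kap ^ R) by lia.
  by apply: leq_trans h2 _; lia.
have rich_bound a : a \in A -> rich c R A a ->
  #|[set y | overwrite z a y \in B]| * kap ^ R <= Y * kap.-1 ^ R.
  move=> aA /existsP[L /and3P[/allP LA /allP Lc Lp]].
  (* Hardness on the kernel of a petal gives an assignment that agrees with [z] there and satisfies
     a certificate; off [L], [z] is a mere default. *)
  have ex (b : {ffun V -> Q}) : exists w : {ffun V -> C}, b \in L ->
      (forall v, b v = a v -> w v = z v) /\ exists i, satisfies w i.
    have [bL|_] := boolP (b \in L); last by exists z.
    have [w wz wi] := z_hard (Lc b bL); exists w => _; split=> // v bv.
    by apply: wz; rewrite inE bv.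
  have [w hw] := fin_all_exists ex.
  have := @avoid_card V C Q z a L w Lp (fun b bL => (hw b bL).1).
  rewrite size_tuple; apply: leq_trans; rewrite leq_mul2r; apply/orP; right.
  apply: subset_leq_card; apply/subsetP => y; rewrite !inE => yB.
  apply/allP => b bL; apply/eqP => eqw; have [_ [i wi]] := hw b bL.
  by have := mono b _ i (LA b bL) yB; rewrite eqw wi.
rewrite mulnA big_distrl /=.
apply: (@leq_trans ((\sum_(a in A | rich c R A a) Y * kap.-1 ^ R) * #|Q| ^ c)).
  by rewrite leq_mul2r leq_sum ?orbT // => a /andP[]; apply: rich_bound.
rewrite sum_nat_const.
have : #|[pred a in A | rich c R A a]| <= #|Q| ^ #|V|.
  by rewrite -card_ffun max_card.
move=> h; apply: leq_trans (leq_mul (leq_mul h (leqnn _)) (leqnn _)) _.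
by rewrite -!mulnA (mulnC (kap.-1 ^ R)).
Qed.

(** Every pair [(a, overwrite z a y)] reads [z], so its clique and stable set are disjoint and some
    cut separates them; [cut_card] limits the share of each cut. *)
Lemma CS_separator_bound R (F : {set {set cert_graph} * {set cert_graph}}) :
  0 < #|Q| -> 0 < #|C| -> CS_separator F ->
  #|{ffun V -> C}| ^ R * #|Q| ^ c
  <= #|F| * ((#|V| * R) ^ c * #|{ffun V -> C}| ^ R
             + #|Q| ^ c * #|{ffun V -> C}|.-1 ^ R).
Proof.
move=> Q0 C0 [cutF sepF].
pose A (f : {set cert_graph} * {set cert_graph}) := [set a | pointer_clique a \subset f.1].
pose B (f : {set cert_graph} * {set cert_graph}) := [set y | input_stable y \subset f.2].
pose X f := [set ay | (ay.1 \in A f) && (overwrite z ay.1 ay.2 \in B f)].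
have cov : [set: {ffun V -> Q} * {ffun V * Q -> C}] \subset \bigcup_(f in F) X f.
  apply/subsetP => -[a y] _; apply/bigcupP.
  have [|f fF [fK fS]] := sepF _ _ (@pointer_clique_clique a)
      (input_stable_stable (y := overwrite z a y) unamb); last first.
    by exists f => //; rewrite !inE fK fS.
  rewrite -setI_eq0; apply/eqP/setP => x; rewrite !inE; apply/negP => /andP[h1 h2].
  have [i] := meet_satisfies h1 h2; rewrite read_overwrite.
  by apply/negP.
have := leq_trans (subset_leq_card cov) (leq_card_bigcup _ _).
rewrite cardsT card_prod (card_ffun V Q) => h.
have pos : 0 < #|Q| ^ #|V| * #|{ffun V * Q -> C}|.
  by rewrite muln_gt0 expn_gt0 Q0 card_ffun expn_gt0 C0.
rewrite -(leq_pmul2l pos); apply: leq_trans (leq_mul h (leqnn _)) _.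
rewrite big_distrl /= [X in _ <= X]mulnCA -(sum_nat_const (mem F)); apply: leq_sum => f fF.
(* A satisfied certificate would put a vertex on both sides of the cut. *)
apply: cut_card => a y i; rewrite !inE => af yf; apply/negP => /satisfies_meet[x xa xy].
have [_ /disjoint_setI0 /setP/(_ x)] := cutF f fF.
by rewrite !inE (subsetP af) // (subsetP yf).
Qed.

End CertificateGraph.

(** * Elementary inequalities *)

Lemma sqrn_le_exp2 n : 3 < n -> n ^ 2 <= 2 ^ n.
Proof.
elim: n => // n IH; rewrite ltnS leq_eqVlt => /orP[/eqP <- //|n3].
by have := IH n3; rewrite (expnS 2) -!mulnn; nia.
Qed.

(** Bernoulli's inequality for [1 + 1/x], denominators cleared. *)
Lemma bernoulli_nat x n : x ^ n * (x + n) <= x.+1 ^ n * x.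
Proof.
elim: n => [|n IH]; first by rewrite !expn0 addn0.
by rewrite !expnS; move: IH; set X := x ^ n; set Z := x.+1 ^ n; nia.
Qed.

Lemma exp_beats_monomial K d kap : 0 < kap ->
  exists2 R, K < R & K * R ^ d * kap.-1 ^ R <= kap ^ R.
Proof.
case: kap => [|[|x]] // _ /=; first by exists K.+1; rewrite ?exp0n ?muln0.
set y := x.+1.
have dbl : 2 * y ^ y <= y.+1 ^ y.
  rewrite -(@leq_pmul2r y) //; apply: leq_trans (bernoulli_nat y y).
  by rewrite addnn -muln2; lia.
(* For [R = y * s], [dbl] reduces the claim to [K * y ^ d * s ^ d <= 2 ^ s], which follows from
   [K * y ^ d + u * d <= u ^ 2 <= s]. *)
pose u := d + K * y ^ d + K + 4; pose s := 2 ^ u.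
have us : u ^ 2 <= s by apply: sqrn_le_exp2; rewrite /u; lia.
have Ks : K < y * s.
  by apply: leq_trans (leq_pmull _ _) => //; apply: leq_trans us; rewrite /u; nia.
exists (y * s) => //; rewrite !expnM.
apply: (@leq_trans ((2 * y ^ y) ^ s)); last by rewrite leq_exp2r ?expn_gt0.
rewrite (expnMn 2) leq_mul2r; apply/orP; right.
rewrite expnMn mulnA.
apply: (@leq_trans (2 ^ (K * y ^ d) * 2 ^ (u * d))).
  by apply: leq_mul; [apply/ltnW/ltn_expl | rewrite expnM].
rewrite -expnD leq_exp2l //; apply: leq_trans us.
by rewrite /u; set A := K * _; nia.
Qed.

(** * Certificates from layered witnesses *)

Section Instance.
Variables m t : nat.

(* The left cells of a layer are the white ones. *)
Let layer : finType := ('I_t * 'I_t)%type.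
Let cell : finType := (layer * ('I_t + layer))%type.
Let place : finType := ('I_t * 'I_t + layer)%type.
Let wcert : finType := ({ffun 'I_t -> layer} * {ffun layer -> layer})%type.
Let bcert : finType := (layer * 'I_t)%type.

(* The white witness [W] takes all white cells of the layers [W.1 j] and the black
   cell [W.2 l] of the other layers [l]. *)
Definition wcell (W : wcert) (s : place) : cell :=
  match s with
  | inl (j, x) => (W.1 j, inl x)
  | inr l => if [pick j | W.1 j == l] is Some j then (l, inl j) else (l, inr (W.2 l))
  end.

Definition bcell (B : bcert) (s : place) : cell :=
  match s with
  | inl _ => (B.1, inl B.2)
  | inr y => (B.1, inr y)
  end.

Definition cellcolor (x : cell) : bool := if x.2 is inl _ then true else false.

(** In the layer of [B], [W] takes either all white cells, including that of [B], or a black cell,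
    and [B] has them all. *)
Lemma wcell_bcell W B : exists s s', wcell W s = bcell B s'.
Proof.
case: B => l x; case: (pickP (fun j => W.1 j == l)) => [j /eqP Wj|noj].
  by exists (inl (j, x)), (inl (x, x)); rewrite /= Wj.
by exists (inr l), (inr (W.2 l)) => /=; case: pickP => // j; rewrite noj.
Qed.

(** Fewer than [t] layers have all their [t ^ 2] black cells in [T]; these are taken white, and
    every other layer offers a black cell outside [T]. *)
Lemma wcell_avoid (T : {set cell}) : #|T| < t ^ 3 ->
  exists W, forall s, wcell W s \in T -> cellcolor (wcell W s).
Proof.
move=> hT; have t_gt0 : 0 < t by case: t hT.
have l0 : layer := (Ordinal t_gt0, Ordinal t_gt0).
pose full : {set layer} := [set l | [forall y, (l, inr y) \in T]].
have full_small : #|full| < t.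
  pose f (ly : layer * layer) : cell := (ly.1, inr ly.2).
  have f_inj : injective f by move=> [l y] [l' y'] [-> ->].
  have : #|[set f ly | ly in setX full setT]| <= #|T|.
    apply/subset_leq_card/subsetP => _ /imsetP[[l y] + ->].
    by rewrite !inE andbT => /forallP; apply.
  rewrite card_imset // cardsX cardsT card_prod card_ord => h.
  rewrite -(@ltn_pmul2r (t * t)) ?muln_gt0 ?t_gt0 //.
  by apply: leq_ltn_trans h _; rewrite !expnS expn0 muln1 in hT.
pose J : {ffun 'I_t -> layer} := [ffun j : 'I_t => nth l0 (enum full) j].
(* The default [l0] occurs only on full layers, where white cells are taken instead. *)
pose g : {ffun layer -> layer} :=
  [ffun l => if [pick y | (l, inr y) \notin T] is Some y then y else l0].
exists (J, g) => -[[j x]|l] //=; case: pickP => //= noj.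
rewrite ffunE; case: pickP => [y /negPf -> //|ally].
have lfull : l \in enum full.
  by rewrite mem_enum inE; apply/forallP => y; have /negbFE := ally y.
have it : index l (enum full) < t.
  by apply: leq_trans (ltnW full_small); rewrite cardE index_mem.
by have := noj (Ordinal it); rewrite ffunE /= nth_index ?eqxx.
Qed.

(** There are [t ^ 3] white cells, so one lies outside [T]. *)
Lemma bcell_avoid (T : {set cell}) : #|T| < t ^ 3 ->
  exists B, forall s, bcell B s \in T -> ~~ cellcolor (bcell B s).
Proof.
move=> hT.
pose f (lx : layer * 'I_t) : cell := (lx.1, inl lx.2).
have f_inj : injective f by move=> [l x] [l' x'] [-> ->].
have /subsetPn [_ /imsetP[[l x] _ ->] nT] : ~~ ([set f lx | lx in setT] \subset T).
  apply: contraTN hT => /subset_leq_card; rewrite card_imset // cardsT -leqNgt.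
  by rewrite !card_prod !card_ord !expnS expn0 muln1 mulnA.
by exists (l, x) => -[[i j]|y] //=; rewrite (negPf nT).
Qed.

Let cert : finType := ({ffun 'I_m -> wcert + bcert})%type.
Let var : finType := ('I_m * cell + {ffun 'I_m -> bool})%type.
Let slot : finType := ('I_m * place + unit)%type.

Definition side (D : (wcert + bcert)%type) : bool := if D is inl _ then true else false.

Definition side_cell (D : (wcert + bcert)%type) : place -> cell :=
  match D with inl W => wcell W | inr B => bcell B end.

Definition sides (i : cert) : {ffun 'I_m -> bool} := [ffun r => side (i r)].

Definition slot_var (i : cert) (s : slot) : var :=
  match s with
  | inl (r, x) => inl (r, side_cell (i r) x)
  | inr _ => inr (sides i)
  end.

Definition slot_val (i : cert) (s : slot) : (bool + cert)%type :=
  match s with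
  | inl (r, _) => inl (side (i r))
  | inr _ => inr i
  end.

(** Lookup entries hold a symbol that names no certificate. *)
Definition blank : {ffun var -> (bool + cert)%type} :=
  [ffun v => if v is inl (_, x) then inl (cellcolor x) else inl false].

Lemma card_slot : #|slot| = m * (2 * t ^ 2) + 1.
Proof. by rewrite card_sum card_prod card_sum !card_prod !card_ord card_unit; lia. Qed.

(** Equal colour vectors use the same lookup entry; otherwise, on some copy, a white and a black
    witness demand different values of a common cell. *)
Lemma slot_unambiguous w i j :
  satisfies slot_var slot_val w i -> satisfies slot_var slot_val w j -> i = j.
Proof.
move=> /forallP hi /forallP hj.
have [eqy|] := eqVneq (sides i) (sides j).
  have /eqP := hi (inr tt); have /eqP := hj (inr tt); rewrite /= eqy => -> [].
  by [].
have cross r W B : i r = inl W -> j r = inr B -> False.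
  move=> ir jr; have [s [s' e]] := wcell_bcell W B.
  have /eqP := hi (inl (r, s)); have /eqP := hj (inl (r, s')).
  by rewrite /= ir jr /= e => ->.
have cross' r W B : j r = inl W -> i r = inr B -> False.
  move=> jr ir; have [s [s' e]] := wcell_bcell W B.
  have /eqP := hj (inl (r, s)); have /eqP := hi (inl (r, s')).
  by rewrite /= ir jr /= e => ->.
case/eqP/ffunP => r; rewrite !ffunE.
by case ir: (i r) => [W|B]; case jr: (j r) => [W'|B'] //=; exfalso; eauto.
Qed.

Lemma blank_unsatisfied i : ~~ satisfies slot_var slot_val blank i.
Proof. by apply/negP => /forallP/(_ (inr tt)); rewrite ffunE. Qed.

(** An entry outside [T] fixes a colour vector; each copy has a witness of its colour consistent
    with [T], and all values outside [T] can be adapted. *)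
Lemma blank_hard (T : {set var}) : #|T| < t ^ 3 -> #|T| < 2 ^ m ->
  exists2 w : {ffun var -> (bool + cert)%type},
    {in T, w =1 blank} & exists i, satisfies slot_var slot_val w i.
Proof.
move=> Tt Tm.
have [y yT] : exists y : {ffun 'I_m -> bool}, (inr y : var) \notin T.
  apply/existsP; rewrite -negb_forall; apply: contraTN Tm => /forallP all.
  rewrite -leqNgt -[2 ^ m](_ : #|[set (inr y : var) | y in [set: {ffun 'I_m -> bool}]]| = _).
    by apply: subset_leq_card; apply/subsetP => _ /imsetP[y _ ->].
  by rewrite card_imset ?cardsT ?card_ffun ?card_bool ?card_ord // => ? ? [].
have avoid r : exists D, side D = y r /\
    forall s, (inl (r, side_cell D s) : var) \in T -> cellcolor (side_cell D s) = y r.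
  pose Tr := [set x | (inl (r, x) : var) \in T].
  have Trt : #|Tr| < t ^ 3.
    apply: leq_ltn_trans Tt; rewrite -(card_imset (f := fun x => inl (r, x) : var)).
      by apply: subset_leq_card; apply/subsetP => _ /imsetP[x + ->]; rewrite inE.
    by move=> ? ? [].
  case yr: (y r).
    have [W hW] := wcell_avoid Trt; exists (inl W); split=> // s sT.
    by apply: hW; rewrite inE.
  have [B hB] := bcell_avoid Trt; exists (inr B); split=> // s sT.
  by apply/negbTE; apply: hB; rewrite inE.
have [D hD] := fin_all_exists avoid.
pose i : cert := [ffun r => D r].
have sy : sides i = y by apply/ffunP => r; rewrite !ffunE; case: (hD r).
exists [ffun v => if v \in T then blank v
                  else match v with inl (r, _) => inl (y r) | inr _ => inr i end].
  by move=> v vT; rewrite ffunE vT.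
exists i; apply/forallP => -[[r s]|[]] /=; last by rewrite ffunE sy (negPf yT).
have [h1 h2] := hD r; rewrite !ffunE h1.
by case: ifP => // /h2 ->.
Qed.

End Instance.

(** * Graphs with a universal vertex *)

Definition has_universal (G : sgraph) : Prop :=
  exists u : G, forall v, v != u -> edge u v.

Lemma has_universal_iso (G H : sgraph) :
  isomorphic G H -> has_universal G -> has_universal H.
Proof.
move=> [f [g fK gK] fe] [u hu]; exists (f u) => v vu.
by rewrite -(gK v) fe hu //; apply: contraNneq vu => <-; rewrite gK.
Qed.

Definition universal_class : graph_class := GraphClass has_universal_iso.

Lemma has_universal_induced (G : sgraph) (A : {set G}) (u : G) :
  u \in A -> (forall v, v != u -> edge u v) -> has_universal (induced A).
Proof. by move=> uA hu; exists (exist _ u uA) => v; rewrite -val_eqE; apply: hu. Qed.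

Lemma has_universal_decomposition (G : sgraph) : has_universal G ->
  complete G \/
  exists G1 G2 : sgraph,
    [/\ star_cutset_decomposition G G1 G2, has_universal G1 & has_universal G2].
Proof.
move=> [u hu].
case: (pickP (fun ab : G * G => (ab.1 != ab.2) && ~~ edge ab.1 ab.2)); last first.
  move=> no; left => x y _ _ xy.
  by have := no (x, y); rewrite /= xy => /negbFE.
move=> [a b] /= /andP[ab nab]; right.
have ua : u != a.
  by case: (eqVneq u a) => // ua; rewrite -ua hu // eq_sym ua in nab.
have ub : u != b.
  by case: (eqVneq u b) => // ub; rewrite edge_sym -ub hu // ub in nab.
pose X := ~: [set a; b].
have uX : u \in X by rewrite !inE negb_or ua ub.
exists (induced ([set a] :|: X)), (induced ([set b] :|: X)).
split; try by apply: (has_universal_induced (u := u)); rewrite // inE uX orbT.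
exists X, [set a], [set b]; split=> //.
- split; last by exists u => // y; rewrite !inE => /andP[yu _]; apply: hu.
  have mem x : x \in [set a; b] -> x \in ~: X by rewrite setCK.
  move=> /(_ (exist _ a (mem a (set21 a b))) (exist _ b (mem b (set22 a b)))).
  (* A path from [a] would start with an edge to [a] or [b]. *)
  case/connectP => -[|[y yX] q] /=; first by move=> _ [ba]; rewrite ba eqxx in ab.
  rewrite {1}/induced_edge /= => /andP[+ _] _.
  by move: (yX); rewrite setCK !inE => /orP[] /eqP ->; rewrite ?edge_irrefl ?(negPf nab).
- split; first by rewrite setCK.
  + by rewrite disjoints1 inE.
  + by apply/set0Pn; exists a; rewrite inE.
  + by apply/set0Pn; exists b; rewrite inE.
- by move=> x y /set1P -> /set1P ->.
Qed.

(** * Choice of parameters and conclusion *)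

Lemma poly_nat_bound (P : {poly rat}) :
  exists K d, forall n, 0 < n -> (P.[n%:R] <= (K * n ^ d)%:R :> rat)%R.
Proof.
pose S := (\sum_(i < size P) `|P`_i|)%R.
exists (Num.bound S), (size P) => n n0.
have S0 : (0 <= S)%R by apply: sumr_ge0.
rewrite horner_coef natrM.
apply: (@le_trans _ _ (S * (n ^ size P)%:R)%R); last first.
  by rewrite ler_wpM2r ?ler0n // ltW // archi_boundP.
rewrite /S mulr_suml; apply: ler_sum => i _.
apply: le_trans (ler_norm _) _; rewrite normrM ler_wpM2l //.
by rewrite normrX normr_nat -natrX ler_nat leq_pexp2l // ltnW.
Qed.

Lemma hard_instance d : exists m t c,
  [/\ c <= t ^ 3, c <= 2 ^ m & 2 * d * (m * (2 * t ^ 2) + 1) < c].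
Proof.
(* With [t = 2 ^ u], [m = 3 * u] and [c = t ^ 3 = 2 ^ m], certificates have at most [7 * u * t ^ 2]
   slots; [14 * d < u] and [u ^ 2 <= t] suffice. *)
have [u ud] : exists u, u = 15 * d.+1 by eexists.
have us : u ^ 2 <= 2 ^ u by apply: sqrn_le_exp2; lia.
have pos : 0 < 2 ^ u by rewrite expn_gt0.
exists (3 * u), (2 ^ u), (2 ^ (3 * u)); split=> //; first by rewrite mulnC expnM.
rewrite (_ : 2 ^ (3 * u) = 2 ^ u * (2 ^ u) ^ 2); last by rewrite -expnS -expnM mulnC.
move: (2 ^ u) us pos => t; rewrite -!mulnn => us t0.
have h : 2 * d * 7 * u <= u * u by nia.
have h2 := leq_mul h (leqnn (t * t)).
nia.
Qed.

Lemma cert_graph_superpolynomial (V C I K : finType) (e : I -> K -> V)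
    (p : I -> K -> C) (z : {ffun V -> C}) c k0 d :
  (forall w i j, satisfies e p w i -> satisfies e p w j -> i = j) ->
  (forall i, ~~ satisfies e p z i) ->
  (forall T : {set V}, #|T| < c ->
    exists2 w : {ffun V -> C}, {in T, w =1 z} & exists i, satisfies e p w i) ->
  2 * d * #|K| < c ->
  exists q, forall F : {set {set cert_graph e 'I_q} * {set cert_graph e 'I_q}},
    CS_separator F -> k0 * #|cert_graph e 'I_q| ^ d < #|F|.
Proof.
move=> unamb unsat hard dc; have cV := hard_leq unsat hard.
have V0 : 0 < #|V| by lia.
have C0 : 0 < #|C| by have /card_gt0P[v _] := V0; apply/card_gt0P; exists (z v).
pose kap := #|{ffun V -> C}|.
have kap0 : 0 < kap by rewrite /kap card_ffun expn_gt0 C0.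
pose k1 := k0 * (#|I|.+1 * #|V| ^ #|K|) ^ d.
have [R Rk1 Rexp] := exp_beats_monomial (2 * k1) (2 * d * #|K|) kap0.
have R0 : 0 < R by lia.
(* This makes [q ^ c] equal to [(#|V| * R) ^ c * R ^ c], while the [d]-th power of the number of
   vertices is of order [R ^ (2 * d * #|K|)], below [R ^ c]. *)
exists (#|V| * R * R) => F sepF; have Q0 : 0 < #|V| * R * R by rewrite !muln_gt0 V0 R0.
have := CS_separator_bound unamb unsat hard R _ C0 sepF.
rewrite card_cert_graph (ltnNge _ #|F|).
move: #|F| => M; rewrite card_ord expnMn => /(_ Q0).
have nR0 : 0 < (#|V| * R) ^ c by rewrite expn_gt0 muln_gt0 V0 R0.
rewrite mulnCA -mulnA -mulnDr [X in _ <= X]mulnCA leq_pmul2l // -/kap => bound.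
apply/negP => Mle.
have Mle' : M <= k1 * R ^ (2 * d * #|K|).
  apply: leq_trans Mle _.
  rewrite /k1 -[X in _ <= X]mulnA leq_mul2l; apply/orP; right.
  rewrite (_ : 2 * d * #|K| = 2 * #|K| * d); last by lia.
  rewrite (expnM R) -expnMn.
  apply: leq_trans (_ : (#|I|.+1 * (#|V| * R * R) ^ #|K|) ^ d <= _).
    case: (posnP d) => [->|d0]; first by rewrite !expn0.
    by rewrite leq_exp2r // mulSn -add1n leq_add2r expn_gt0 Q0.
  by rewrite -(mulnA #|V|) mulnn (expnMn #|V|) -expnM mulnA.
(* If [M] were small, each of the two terms on the right of [bound] would be at most half of the
   left side, the first one strictly less. *)
have big : 2 * M * kap ^ R < R ^ c * kap ^ R.
  rewrite ltn_pmul2r ?expn_gt0 ?kap0 //.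
  apply: (@leq_trans (R ^ (2 * d * #|K|).+1)); last by rewrite leq_pexp2l.
  rewrite expnS; apply: leq_ltn_trans (leq_mul (leqnn 2) Mle') _.
  by rewrite mulnA ltn_pmul2r // expn_gt0 R0.
have small : 2 * M * kap.-1 ^ R <= kap ^ R.
  by apply: leq_trans Rexp; rewrite leq_mul2r -(mulnA 2 k1) leq_mul2l Mle' !orbT.
have := leq_mul (leqnn (R ^ c)) small.
move: big bound; set A := kap ^ R; set B := kap.-1 ^ R; set E := R ^ c.
by rewrite mulnDr !mulnA; nia.
Qed.

Theorem theorem11 :
  exists D : graph_class,
    (forall G : sgraph, D G ->
       complete G \/
       exists G1 G2 : sgraph,
         [/\ star_cutset_decomposition G G1 G2, D G1 & D G2]) /\
    ~ polynomial_CS_separation D.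
Proof.
exists universal_class; split=> [|[P hP]]; first exact: has_universal_decomposition.
have [k0 [d hP']] := poly_nat_bound P.
have [m [t [c [c3 c2 hc]]]] := hard_instance d.
rewrite -card_slot in hc.
have [q hq] := cert_graph_superpolynomial k0 (@slot_unambiguous m t)
  (@blank_unsatisfied m t)
  (fun T Tc => blank_hard (leq_trans Tc c3) (leq_trans Tc c2)) hc.
have [|F sepF] := hP (cert_graph (@slot_var m t) 'I_q).
  by exists None => -[x|].
have := hq F sepF.
rewrite ltnNge -(ler_nat rat) => /negP lt le; apply: lt; apply: le_trans le _.
by apply: hP'; rewrite card_cert_graph.
Qed.
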